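(* Let $\mathbb{F}_q$ be a finite field with $\mathrm{char}(\mathbb{F}_q)>3$ and $3\mid q-1$. Then $\mathfrak{sl}_3(\mathbb{F}_q)$ has a unique COD up to conjugacy, represented by $J_3(1,1)$.
   Context: $\mathfrak{sl}_n(\mathbb{F})$ denotes the Lie algebra of $n\times n$ traceless matrices over $\mathbb{F}$. A Cartan subalgebra is a nilpotent self-normalizing subalgebra. A classical Cartan subalgebra of $\mathfrak{L}=\mathfrak{sl}_n(\mathbb{F})$ (with $\ell=\mathrm{char}\,\mathbb{F}$) is an abelian Cartan subalgebra $H$ such that: (a) $\mathfrak{L}=\bigoplus_\alpha \mathfrak{L}_\alpha$ with $\mathfrak{L}_\alpha=\{x: [x,h]=\alpha(h)x\ \forall h\in H\}$ over linear functionals $\alpha$ on $H$ (roots); (b) for each root $\alpha\ne0$, $[\mathfrak{L}_\alpha,\mathfrak{L}_{-\alpha}]$ is one-dimensional; (c) for roots $\alpha,\beta$ with $\beta\neq0$, not all $\alpha+k\beta$ ($1\le k\le \ell-1$) are roots. The Killing form is $K(A,B)=2n\,\mathrm{Tr}(AB)$. A COD of $\mathfrak{sl}_n(\mathbb{F})$ is a vector space decomposition $\mathfrak{sl}_n(\mathbb{F})=H_0\oplus\cdots\oplus H_n$ into classical Cartan subalgebras that are pairwise orthogonal with respect to $K$. Two CODs are conjugate if there is a Lie algebra automorphism of $\mathfrak{sl}_n(\mathbb{F})$ mapping each component of the first decomposition onto exactly one component of the second. Fix a primitive cube root of unity $u\in\mathbb{F}_q$; $J_3(1,1)$ denotes the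 decomposition $\mathfrak{sl}_3(\mathbb{F}_q)=H_0\oplus H_1\oplus H_2\oplus H_3$ where $H_0$ is the traceless diagonal matrices and, for $j=1,2,3$ with $(\lambda_j,\mu_j)=(1,1),(u,u^2),(u^2,u)$, $H_j=\left\langle \begin{pmatrix}0&1&0\\0&0&\lambda_j\\ \mu_j&0&0\end{pmatrix},\begin{pmatrix}0&0&1\\ \mu_j&0&0\\0&\lambda_j&0\end{pmatrix}\right\rangle_{\mathbb{F}_q}$. *)

(* Defs.v *)
From HB Require Import structures.
From mathcomp Require Import all_boot all_order all_algebra.
Set Implicit Arguments. Unset Strict Implicit. Unset Printing Implicit Defensive.
Import Order.TTheory GRing.Theory.
Local Open Scope ring_scope.

Section LieDefs.
Variable F : finFieldType.
Variable n : nat.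

Definition bracket (x y : 'M[F]_n) : 'M[F]_n := x *m y - y *m x.

Definition is_sl (x : 'M[F]_n) : bool := \tr x == 0.

(* the subspace of 'M[F]_n spanned by the matrices satisfying P
   (equal to {x | P x} when that set is a subspace) *)
Definition vspace_of_pred (P : pred 'M[F]_n) : {vspace 'M[F]_n} :=
  <<[seq x <- enum 'M[F]_n | P x]>>%VS.

Definition slv : {vspace 'M[F]_n} := vspace_of_pred is_sl.

Definition memv_enum (U : {vspace 'M[F]_n}) : seq 'M[F]_n :=
  [seq x <- enum 'M[F]_n | x \in U].

Definition commv (U V : {vspace 'M[F]_n}) : {vspace 'M[F]_n} :=
  <<[seq bracket x y | x <- memv_enum U, y <- memv_enum V]>>%VS.

Definition killing (A B : 'M[F]_n) : F := (2 * n)%:R * \tr (A *m B).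

Definition subalgebra (H : {vspace 'M[F]_n}) : Prop :=
  (forall x, x \in H -> is_sl x) /\
  (forall x y, x \in H -> y \in H -> bracket x y \in H).

(* H is nilpotent: H^k = 0 for some k, i.e. all k-fold brackets
   [x_1,[x_2,...[x_k,y]...]] of elements of H vanish *)
Definition nilpotent_sub (H : {vspace 'M[F]_n}) : Prop :=
  exists k : nat, forall (s : seq 'M[F]_n) (y : 'M[F]_n),
    all (fun x => x \in H) s -> size s = k -> y \in H ->
    foldr bracket y s = 0.

Definition self_normalizing (H : {vspace 'M[F]_n}) : Prop :=
  forall x, is_sl x -> (forall h, h \in H -> bracket x h \in H) -> x \in H.

Definition cartan_sub (H : {vspace 'M[F]_n}) : Prop :=
  [/\ subalgebra H, nilpotent_sub H & self_normalizing H].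

Definition abelian_sub (H : {vspace 'M[F]_n}) : Prop :=
  forall x y, x \in H -> y \in H -> bracket x y = 0.

(* Linear functionals on H, represented as functions on 'M[F]_n that are
   linear on H and vanish outside H (canonical extension by zero). *)
Definition lin_on (H : {vspace 'M[F]_n}) (a : {ffun 'M[F]_n -> F}) : bool :=
  [forall x, forall y, forall c : F,
     (x \in H) ==> (y \in H) ==> (a (c *: x + y) == c * a x + a y)]
  && [forall x, (x \notin H) ==> (a x == 0)].

Definition rootsp (H : {vspace 'M[F]_n}) (a : {ffun 'M[F]_n -> F}) :
  {vspace 'M[F]_n} :=
  vspace_of_pred (fun x => is_sl x &&
    [forall h, (h \in H) ==> (bracket x h == a h *: x)]).

Definition is_root (H : {vspace 'M[F]_n}) (a : {ffun 'M[F]_n -> F}) : bool :=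
  lin_on H a && (rootsp H a != 0%VS).

Definition negf (a : {ffun 'M[F]_n -> F}) : {ffun 'M[F]_n -> F} :=
  [ffun x => - a x].

Definition addmulf (a b : {ffun 'M[F]_n -> F}) (k : nat) :
  {ffun 'M[F]_n -> F} := [ffun x => a x + k%:R * b x].

(* classical Cartan subalgebra, l = char F *)
Definition classical_cartan (l : nat) (H : {vspace 'M[F]_n}) : Prop :=
  [/\ abelian_sub H, cartan_sub H,
      (\sum_(a | lin_on H a) rootsp H a)%VS = slv /\
        directv (\sum_(a | lin_on H a) rootsp H a),
      (forall a, is_root H a -> a != 0 ->
         \dim (commv (rootsp H a) (rootsp H (negf a))) = 1%N) &
      (forall a b, is_root H a -> is_root H b -> b != 0 ->
         ~ (forall k, (1 <= k <= l.-1)%N -> is_root H (addmulf a b k)))].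

Definition is_COD (l : nat) (H : 'I_n.+1 -> {vspace 'M[F]_n}) : Prop :=
  [/\ (\sum_i H i)%VS = slv, directv (\sum_i H i),
      (forall i, classical_cartan l (H i)) &
      (forall i j, i != j -> forall x y, x \in H i -> y \in H j ->
         killing x y = 0)].

(* Lie algebra automorphism of sl_n(F) (values outside sl_n irrelevant) *)
Definition lie_aut (phi : 'M[F]_n -> 'M[F]_n) : Prop :=
  [/\ (forall x, is_sl x -> is_sl (phi x)),
      (forall (c : F) x y, is_sl x -> is_sl y ->
         phi (c *: x + y) = c *: phi x + phi y),
      (forall x y, is_sl x -> is_sl y ->
         phi (bracket x y) = bracket (phi x) (phi y)),
      (forall x y, is_sl x -> is_sl y -> phi x = phi y -> x = y) &
      (forall y, is_sl y -> exists2 x, is_sl x & phi x = y)].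

Definition maps_onto (phi : 'M[F]_n -> 'M[F]_n) (U V : {vspace 'M[F]_n}) :
  Prop := forall y, y \in V <-> exists2 x, x \in U & phi x = y.

Definition cod_conj (H H' : 'I_n.+1 -> {vspace 'M[F]_n}) : Prop :=
  exists phi, lie_aut phi /\
    forall i, exists! j, maps_onto phi (H i) (H' j).

End LieDefs.

Definition mx3 (F : finFieldType) (a b c d e f g h k : F) : 'M[F]_3 :=
  \matrix_(i < 3, j < 3)
    nth 0 (nth [::] [:: [:: a; b; c]; [:: d; e; f]; [:: g; h; k]] i) j.

Definition J3_H0 (F : finFieldType) : {vspace 'M[F]_3} :=
  vspace_of_pred (fun A : 'M[F]_3 => is_diag_mx A && is_sl A).

Definition J3_Hj (F : finFieldType) (lam mu : F) : {vspace 'M[F]_3} :=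
  let A := mx3 0 1 0 0 0 lam mu 0 0 in
  let B := mx3 0 0 1 mu 0 0 0 lam 0 in
  <<[:: A; B]>>%VS.

(* J_3(1,1) with respect to the primitive cube root of unity u *)
Definition J3 (F : finFieldType) (u : F) (i : 'I_4) : {vspace 'M[F]_3} :=
  match val i with
  | 0 => J3_H0 F
  | 1 => J3_Hj 1 1
  | 2 => J3_Hj u (u ^+ 2)
  | _ => J3_Hj (u ^+ 2) u
  end.

(* Main.v *)
Require Import Defs.
From HB Require Import structures.
From mathcomp Require Import all_boot all_order all_algebra ring.
Import GRing.Theory.
Local Open Scope ring_scope.
Set Implicit Arguments. Unset Strict Implicit. Unset Printing Implicit Defensive.

(* A classical Cartan subalgebra [H] of sl_3 is conjugate to the diagonal one. A root
   vector [x] of a nonzero root is singular, so its row space or its row kernel is a line,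
   stable under [H]: this gives a common eigenrow [w] of [H]. If [x] is a root vector then
   [w x] is again a common eigenrow, and as the root vectors span sl_3 these eigenrows span
   the whole space. Self-normalization then shows that [H] is a full torus.

   Take the first component of a decomposition to be diagonal. Orthogonality of another
   component [m T m^-1] to it says that all [m i j * m^-1 j i] equal 1/3, i.e. [m] is a
   generalized Hadamard matrix of order 3, hence a Fourier matrix up to scaling and
   permutation; so the component consists of the circulant matrices of zero diagonal
   conjugated by some [D = diag(1, r, s)]. Conjugating by a diagonal matrix makes [D = 1]
   for the second component; for the others, orthogonality to the second one then forces
   [r], [s / r], [1 / s] to be the three cube roots of unity in some order, which leaves
   exactly the last two components of J_3(1,1). *)

(** * Entrywise calculus of 3 by 3 matrices *)

Section Mx3.
Variable F : finFieldType.
Implicit Types a b c d e f g h k : F.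

Lemma mx3_eta (A : 'M[F]_3) :
  A = mx3 (A 0 0) (A 0 1) (A 0 2) (A 1 0) (A 1 1) (A 1 2) (A 2 0) (A 2 1) (A 2 2).
Proof.
apply/matrixP => i j; rewrite mxE.
by case: i => [[|[|[|//]]] ?]; case: j => [[|[|[|//]]] ?] /=; congr (A _ _); apply/val_inj.
Qed.

Lemma mx3_mul a b c d e f g h k a' b' c' d' e' f' g' h' k' :
  mx3 a b c d e f g h k *m mx3 a' b' c' d' e' f' g' h' k' =
  mx3 (a * a' + b * d' + c * g') (a * b' + b * e' + c * h') (a * c' + b * f' + c * k')
      (d * a' + e * d' + f * g') (d * b' + e * e' + f * h') (d * c' + e * f' + f * k')
      (g * a' + h * d' + k * g') (g * b' + h * e' + k * h') (g * c' + h * f' + k * k').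
Proof.
apply/matrixP => i j; rewrite !mxE !big_ord_recl big_ord0 !mxE addr0 addrA.
by case: i => [[|[|[|//]]] ?]; case: j => [[|[|[|//]]] ?].
Qed.

Lemma mx3_add a b c d e f g h k a' b' c' d' e' f' g' h' k' :
  mx3 a b c d e f g h k + mx3 a' b' c' d' e' f' g' h' k' =
  mx3 (a + a') (b + b') (c + c') (d + d') (e + e') (f + f') (g + g') (h + h') (k + k').
Proof.
apply/matrixP => i j; rewrite !mxE.
by case: i => [[|[|[|//]]] ?]; case: j => [[|[|[|//]]] ?].
Qed.

Lemma mx3_scale (l : F) a b c d e f g h k :
  l *: mx3 a b c d e f g h k =
  mx3 (l * a) (l * b) (l * c) (l * d) (l * e) (l * f) (l * g) (l * h) (l * k).
Proof.
apply/matrixP => i j; rewrite !mxE.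
by case: i => [[|[|[|//]]] ?]; case: j => [[|[|[|//]]] ?].
Qed.

Lemma mx3_tr a b c d e f g h k : \tr (mx3 a b c d e f g h k) = a + e + k.
Proof. by rewrite /mxtrace !big_ord_recl big_ord0 !mxE /= addr0 addrA. Qed.

Lemma mx3_scalar (l : F) : l%:M = mx3 l 0 0 0 l 0 0 0 l.
Proof.
apply/matrixP => i j; rewrite !mxE.
by case: i => [[|[|[|//]]] ?]; case: j => [[|[|[|//]]] ?]; rewrite //= ?mulr0n ?mulr1n.
Qed.

Lemma mx3_diag a b c d e f g h k :
  is_diag_mx (mx3 a b c d e f g h k) =
  [&& b == 0, c == 0, d == 0, f == 0, g == 0 & h == 0].
Proof.
apply/is_diag_mxP/idP => [D|].
  have := (D 0 1 isT, D 0 2 isT, (D 1 0 isT, D 1 2 isT), (D 2 0 isT, D 2 1 isT)).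
  by rewrite !mxE /= => -[[[-> ->] [-> ->]] [-> ->]]; rewrite !eqxx.
case/and5P => /eqP-> /eqP-> /eqP-> /eqP-> /andP[/eqP-> /eqP->] i j; rewrite !mxE.
by case: i => [[|[|[|//]]] ?]; case: j => [[|[|[|//]]] ?].
Qed.
End Mx3.

(** * Root spaces and diagonalizable tori *)

Section Spaces.
Variables (F : finFieldType) (n : nat).
Implicit Types (x y z h : 'M[F]_n) (H : {vspace 'M[F]_n}).

Lemma mem_vspace_of_pred (P : pred 'M[F]_n) x :
  P 0 -> (forall (c : F) y z, P y -> P z -> P (c *: y + z)) ->
  (x \in vspace_of_pred P) = P x.
Proof.
move=> P0 PD; apply/idP/idP => [|Px].
  rewrite /vspace_of_pred; set X := filter _ _ => /(@coord_span _ _ _ (in_tuple X)) ->.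
  apply: (big_ind (fun z => P z)) => // [y z Py Pz|i _]; first by rewrite -[y]scale1r PD.
  rewrite -[_ *: _]addr0 PD //.
  have : (in_tuple X)`_i \in X by exact: (mem_nth 0 (ltn_ord i)).
  by rewrite mem_filter => /andP[].
by apply: memv_span; rewrite mem_filter Px mem_enum.
Qed.

Lemma mem_slv x : (x \in slv F n) = is_sl x.
Proof.
apply: mem_vspace_of_pred => [|c y z]; rewrite /is_sl ?linear0 //.
by move=> /eqP ty /eqP tz; rewrite mxtraceD mxtraceZ ty tz mulr0 addr0.
Qed.

Lemma bracket_linear c x y h : bracket (c *: x + y) h = c *: bracket x h + bracket y h.
Proof.
rewrite /bracket mulmxDl mulmxDr -scalemxAl -scalemxAr scalerBr.
by rewrite opprD addrACA.
Qed.

Lemma rootspP H (a : {ffun 'M[F]_n -> F}) x :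
  reflect (is_sl x /\ forall h, h \in H -> bracket x h = a h *: x) (x \in rootsp H a).
Proof.
rewrite mem_vspace_of_pred.
- apply: (iffP andP) => -[sx].
    by move/forallP=> E; split=> // h hH; have /implyP/(_ hH)/eqP := E h.
  by move=> E; split=> //; apply/forallP => h; apply/implyP => /E ->.
- rewrite /is_sl linear0 eqxx; apply/forallP => h; apply/implyP => _.
  by rewrite /bracket mul0mx mulmx0 subr0 scaler0.
move=> c y z /andP[sy /forallP Ey] /andP[sz /forallP Ez].
rewrite /is_sl mxtraceD mxtraceZ (eqP sy) (eqP sz) mulr0 addr0 eqxx.
apply/forallP => h; apply/implyP => hH.
have /implyP/(_ hH)/eqP Eyh := Ey h; have /implyP/(_ hH)/eqP Ezh := Ez h.
by rewrite bracket_linear Eyh Ezh scalerDr !scalerA mulrC.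
Qed.

Lemma is_diag_mxC x y : is_diag_mx x -> is_diag_mx y -> x *m y = y *m x.
Proof.
move=> /diag_mxP[d ->] /diag_mxP[e ->]; rewrite !mulmx_diag.
by congr diag_mx; apply/rowP=> i; rewrite !mxE mulrC.
Qed.

(* [g] acts on rows: the rows of [g] are common eigenvectors of [H]. *)
Definition torus (g : 'M[F]_n) x := is_sl x && is_diag_mx (g *m x *m invmx g).

Definition toral (g : 'M[F]_n) H := g \in unitmx /\ forall x, (x \in H) = torus g x.

Lemma conj_mulmx g x y : g \in unitmx ->
  g *m (x *m y) *m invmx g = (g *m x *m invmx g) *m (g *m y *m invmx g).
Proof. by move=> ug; rewrite !mulmxA mulmxKV. Qed.

Lemma conj_inj g x y : g \in unitmx -> g *m x *m invmx g = g *m y *m invmx g -> x = y.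
Proof.
move=> ug /(congr1 (fun z => invmx g *m z *m g)).
by rewrite !mulmxA !mulVmx // !mul1mx !mulmxKV.
Qed.

Lemma conj_tr g x : g \in unitmx -> \tr (g *m x *m invmx g) = \tr x.
Proof. by move=> ug; rewrite mxtrace_mulC mulmxA mulVmx // mul1mx. Qed.

Lemma torus_comm g x y : g \in unitmx -> torus g x -> torus g y -> bracket x y = 0.
Proof.
move=> ug /andP[_ dx] /andP[_ dy]; apply/eqP; rewrite subr_eq0; apply/eqP.
by apply: (conj_inj ug); rewrite !conj_mulmx // is_diag_mxC.
Qed.

End Spaces.

(** * Root vectors acting on common eigenrows *)

Section EigenRows.
Variables (F : finFieldType) (n : nat).
Implicit Types (x y z h : 'M[F]_n) (H : {vspace 'M[F]_n}).

(** The zero row is allowed, so that an eigenrow times a root vector always qualifies. *)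
Definition eigenrow H (w : 'rV[F]_n) := [forall h, (h \in H) ==> (w *m h <= w)%MS].

Lemma eigenrowP H w :
  reflect (forall h, h \in H -> (w *m h <= w)%MS) (eigenrow H w).
Proof. by apply: (iffP forallP) => E h; apply/implyP/E. Qed.

(** For invertible [x], the matrix [x^-1 [x, h] = h - x^-1 h x] has trace zero, but it is also the
    scalar matrix [a h], of trace [n * a h]. *)
Lemma root_singular H a x h : (n%:R != 0 :> F) -> x \in rootsp H a -> h \in H ->
  a h != 0 -> x \notin unitmx.
Proof.
move=> n0 /rootspP[_ E] hH; apply: contraNN => ux.
have := congr1 (fun z => \tr (invmx x *m z)) (E h hH).
rewrite /bracket mulmxBr -scalemxAr mulmxA mulVmx // mul1mx linearB mxtraceZ /=.
rewrite mulmxA mxtrace_mulC mulmxA mulmxV // mul1mx subrr mxtrace_scalar => /esym/eqP.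
by rewrite mulf_eq0 (negPf n0) orbF.
Qed.

(** From [x h = h x + a(h) x], right multiplication by [x] shifts the eigenvalue of [h] by [a h]. *)
Lemma eigenrow_root H a x w : x \in rootsp H a -> eigenrow H w -> eigenrow H (w *m x).
Proof.
move=> /rootspP[_ E] /eigenrowP ew; apply/eigenrowP => h hH.
have /sub_rVP[l wh] := ew h hH.
have -> : w *m x *m h = (l + a h) *: (w *m x).
  rewrite scalerDl !scalemxAl -wh -scalemxAl scalemxAr -E // /bracket.
  by rewrite mulmxBr !mulmxA addrC subrK.
exact: scalemx_sub.
Qed.

Lemma stable_line_eigenrow H (U : 'M[F]_n) : \rank U = 1%N ->
  (forall h, h \in H -> (U *m h <= U)%MS) -> exists2 w, w != 0 & eigenrow H w.
Proof.
move=> rU sU; exists (nz_row U); first by rewrite nz_row_eq0 -mxrank_eq0 rU.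
apply/eigenrowP => h hH.
have wU : (nz_row U <= U)%MS by apply: nz_row_sub.
have Uw : (U <= nz_row U)%MS.
  by rewrite -(mxrank_leqif_sup wU) rU rank_rV nz_row_eq0 -mxrank_eq0 rU.
by apply: submx_trans Uw; apply: submx_trans (sU h hH); apply: submxMr.
Qed.

End EigenRows.

(** * Classical Cartan subalgebras are tori *)

Section Classical.
Variable (F : finFieldType).
Hypothesis F3 : 3%:R != 0 :> F.
Implicit Types (x y z h : 'M[F]_3) (H : {vspace 'M[F]_3}).

Lemma root_eigenrow H a x h : x \in rootsp H a -> x != 0 -> h \in H -> a h != 0 ->
  exists2 w, w != 0 & eigenrow H w.
Proof.
move=> xa x0 hH ah; have xs := root_singular F3 xa hH ah.
have /rootspP[_ E] := xa.
have : (\rank x < 3)%N.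
  by rewrite ltn_neqAle rank_leq_row andbT; apply: contraNN xs; rewrite -row_free_unit.
have : (0 < \rank x)%N by rewrite lt0n mxrank_eq0.
case rx: (\rank x) => [|[|[|//]]] // _ _.
  (* Rank 1: the row space of [x] is stable, because [x k = (k + a(k)) x]. *)
  apply: (stable_line_eigenrow rx) => k kH.
  have -> : x *m k = (k + (a k)%:M) *m x.
    by rewrite mulmxDl mul_scalar_mx -E // /bracket addrC subrK.
  exact: submxMl.
(* Rank 2: the left kernel is a line, and [v x = 0] gives [v k x = v (x k - a(k) x) = 0]. *)
apply: (@stable_line_eigenrow _ _ _ (kermx x)); first by rewrite mxrank_ker rx.
move=> k kH; apply/sub_kermxP.
have -> : kermx x *m k *m x = kermx x *m (x *m k - a k *: x).
  by rewrite -E // /bracket subKr mulmxA.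
by rewrite mulmxBr mulmxA -scalemxAr mulmx_ker mul0mx scaler0 subrr.
Qed.

(** Otherwise all root spaces, hence all of sl_3, commute with [H]; self-normalization then gives
    [H = sl_3], which is not abelian. *)
Lemma classical_nonzero_root l H : classical_cartan l H ->
  exists a x h, [/\ x \in rootsp H a, x != 0, h \in H & a h != 0].
Proof.
case=> abH [_ _ sn] [sumH _] _ _.
case: (boolP [exists a, exists x, exists h,
    [&& x \in rootsp H a, x != 0, h \in H & a h != 0]]).
  by move=> /existsP[a /existsP[x /existsP[h /and4P[*]]]]; exists a, x, h.
move=> N; suff slH x : is_sl x -> x \in H.
  pose e := mx3 0 1 0 0 0 0 0 0 0 : 'M[F]_3; pose f := mx3 0 0 0 1 0 0 0 0 0 : 'M[F]_3.
  have : bracket e f = 0 by apply: abH; apply: slH; rewrite /is_sl mx3_tr !addr0.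
  move/matrixP/(_ 0 0); rewrite /bracket !mx3_mul !mxE /= !mulr0 !addr0 subr0 mulr1.
  by move/eqP; rewrite add0r oner_eq0.
move=> sx; apply: sn => // h hH.
suff -> : bracket x h = 0 by apply: mem0v.
move: sx; rewrite -mem_slv -sumH => /memv_sumP[y yr ->].
apply: (big_rec (fun z => bracket z h = 0)) => [|a z la Ez].
  by rewrite /bracket mul0mx mulmx0 subrr.
rewrite -[y a]scale1r bracket_linear Ez addr0 scale1r.
have /rootspP[_ /(_ h hH) ->] := yr a la.
have [->|y0] := eqVneq (y a) 0; first by rewrite scaler0.
have [->|ah] := eqVneq (a h) 0; first by rewrite scale0r.
case/negP: N; apply/existsP; exists a; apply/existsP; exists (y a); apply/existsP; exists h.
by rewrite yr // y0 hH.
Qed.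

Lemma classical_toral l H : classical_cartan l H -> exists g, toral g H.
Proof.
move=> cH; have [a [x [h [xa x0 hH ah]]]] := classical_nonzero_root cH.
have [w w0 ew] := root_eigenrow xa x0 hH ah.
case: cH => abH [[slH _] _ sn] [sumH _] _ _.
pose S := [set w | eigenrow H w].
pose A : 'M[F]_(#|S|, 3) := \matrix_i (enum_val i).
have SA v : eigenrow H v -> (v <= A)%MS.
  move=> ev; have vS : v \in S by rewrite inE.
  by have := row_sub (enum_rank_in vS v) A; rewrite rowK enum_rankK_in.
(* Any row [v] is [w y] for some [y], since [w] has a nonzero entry. Subtracting a scalar makes [y]
   traceless at the cost of a multiple of [w]; a sum of root vectors then sends [w] to a sum of
   eigenrows. *)
have fA : row_full A.
  rewrite -sub1mx; apply/row_subP => i; set v := row i _.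
  have [j wj] : exists j, w 0 j != 0.
    apply/existsP; rewrite -negb_forall; apply: contraNN w0 => /forallP w0.
    by apply/eqP/rowP => j; rewrite mxE (eqP (w0 j)).
  pose y := (w 0 j)^-1 *: (delta_mx j 0 *m v).
  have wy : w *m y = v.
    rewrite -scalemxAr mulmxA -colE; have -> : col j w = (w 0 j)%:M.
      by apply/matrixP => p q; rewrite !mxE !ord1 eqxx mulr1n.
    by rewrite mul_scalar_mx scalerA mulVf // scale1r.
  pose t := \tr y / 3%:R.
  have sy : is_sl (y - t%:M).
    by rewrite /is_sl linearB /= mxtrace_scalar -[t *+ 3]mulr_natr /t divfK // subrr.
  have -> : v = w *m (y - t%:M) + t *: w by rewrite mulmxBr mul_mx_scalar subrK.
  apply: addmx_sub; last exact/scalemx_sub/SA.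
  move: sy; rewrite -mem_slv -sumH => /memv_sumP[z zr ->].
  rewrite mulmx_sumr; apply: summx_sub => b lb; apply: SA.
  exact: eigenrow_root (zr b lb) ew.
(* Three independent eigenrows make up [g], which diagonalizes [H]. *)
pose g := rowsub (fullrankfun fA) A.
have ug : g \in unitmx by rewrite -row_full_unit; apply: fullrowsub_full.
have dg k : k \in H -> is_diag_mx (g *m k *m invmx g).
  move=> kH; have /(_ _)/sub_rVP P i : (row i g *m k <= row i g)%MS.
    rewrite /g row_rowsub rowK; have := enum_valP (fullrankfun fA i).
    by rewrite inE => /eigenrowP; apply.
  have [d Ed] : exists d : 'I_3 -> F, forall i, row i g *m k = d i *: row i g.
    by apply: (fin_all_exists P).
  suff -> : g *m k *m invmx g = diag_mx (\row_i d i) by apply: diag_mx_is_diag.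
  apply: (canLR (mulmxK ug)); apply/row_matrixP => i.
  by rewrite mul_diag_mx; apply/rowP => j; move/rowP: (Ed i) => /(_ j); rewrite -row_mul !mxE.
exists g; split=> // k; apply/idP/idP => [kH|tk]; first by rewrite /torus slH ?dg.
(* The whole torus commutes with [H], hence normalizes it, hence lies in it. *)
apply: sn => [|m mH]; first by case/andP: tk.
by rewrite (torus_comm ug tk) ?mem0v // /torus slH ?dg.
Qed.
End Classical.

(** * Tori are classical: the root system A_2 in characteristic above 3 *)

Section ToralClassical.
Variables (F : finFieldType) (p : nat).
Hypotheses (pF : p \in [pchar F]) (p3 : (3 < p)%N).
Variables (g : 'M[F]_3) (H : {vspace 'M[F]_3}).
Hypothesis gH : toral g H.
Implicit Types (x y z h : 'M[F]_3) (i j k l : 'I_3).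

Let ug : g \in unitmx. Proof. by case: gH. Qed.
Let memH x : (x \in H) = torus g x. Proof. by case: gH. Qed.

(** Primality excludes 4. The bound makes 4 invertible and lets root strings run over
    [k = 1, ..., 4]. *)
Lemma pchar_prime_gt4 : (4 < p)%N.
Proof.
have := pcharf_prime pF; rewrite ltn_neqAle p3 andbT.
by case: eqP => // <-.
Qed.

Lemma natF_neq0 m : (0 < m < p)%N -> m%:R != 0 :> F.
Proof. by case/andP=> m0 mp; rewrite -(dvdn_pcharf pF) gtnNdvd. Qed.

Let F2 : 2%:R != 0 :> F. Proof. by apply: natF_neq0; rewrite /= ltnW. Qed.
Let F3 : 3%:R != 0 :> F. Proof. exact: natF_neq0. Qed.

Let cj x := g *m x *m invmx g.

Let cjD x y i j : cj (x + y) i j = cj x i j + cj y i j.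
Proof. by rewrite /cj mulmxDr mulmxDl [LHS]mxE. Qed.

Let cj0 : cj 0 = 0. Proof. by rewrite /cj mulmx0 mul0mx. Qed.

Let cjZ (c : F) x i j : cj (c *: x) i j = c * cj x i j.
Proof. by rewrite /cj -scalemxAr -scalemxAl [LHS]mxE. Qed.

Let cj_sum (I : finType) (P : pred I) (f : I -> 'M[F]_3) i j :
  cj (\sum_(t | P t) f t) i j = \sum_(t | P t) cj (f t) i j.
Proof. by rewrite /cj mulmx_sumr mulmx_suml summxE. Qed.

Let cj_bracket x y : cj (bracket x y) = bracket (cj x) (cj y).
Proof. by rewrite /bracket /cj mulmxBr mulmxBl !conj_mulmx. Qed.

Let cjinv x : cj (invmx g *m x *m g) = x.
Proof. by rewrite /cj !mulmxA mulmxV // mul1mx mulmxK. Qed.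

Let cj_inj x y : cj x = cj y -> x = y. Proof. exact: conj_inj. Qed.

Let is_sl_inv x : is_sl (invmx g *m x *m g) = is_sl x.
Proof. by rewrite /is_sl -[in RHS](cjinv x) conj_tr. Qed.

Let cjH h : h \in H -> cj h = diag_mx (\row_i cj h i i).
Proof.
rewrite memH => /andP[_ /diag_mxP[d E]]; rewrite /cj E; congr diag_mx.
by apply/rowP=> i; rewrite !mxE eqxx mulr1n.
Qed.

Let cj_bracketH x h i j : h \in H ->
  cj (bracket x h) i j = (cj h j j - cj h i i) * cj x i j.
Proof.
move=> hH; rewrite cj_bracket (cjH hH) /bracket mul_diag_mx mul_mx_diag !mxE.
by rewrite !eqxx !mulr1n mulrBl; congr (_ - _); rewrite mulrC.
Qed.

Let hd (d : 'I_3 -> F) := invmx g *m diag_mx (\row_i d i) *m g.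

Let cj_hd d i : cj (hd d) i i = d i.
Proof. by rewrite cjinv !mxE eqxx mulr1n. Qed.

Let hdH d : d 0 + d 1 + d 2 = 0 -> hd d \in H.
Proof.
move=> d0; rewrite memH /torus -/(cj _) cjinv diag_mx_is_diag andbT is_sl_inv /is_sl.
rewrite mxtrace_diag !big_ord_recl big_ord0 !mxE addr0 addrA -d0.
by apply/eqP; congr (_ + d _ + d _); apply/val_inj.
Qed.

(** As [bracket x h] is [x h - h x], the entry [(i, j)] has weight [h_j - h_i]. The value 0 outside
    [H] follows the convention of [lin_on]. *)
Definition root_at i j : {ffun 'M[F]_3 -> F} :=
  [ffun x => if x \in H then cj x j j - cj x i i else 0].

Let root_at_hd d i j : d 0 + d 1 + d 2 = 0 -> root_at i j (hd d) = d j - d i.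
Proof. by move=> d0; rewrite ffunE hdH // !cj_hd. Qed.

Let rootspE a x : (x \in rootsp H a) <->
  is_sl x /\ forall i j h, h \in H -> cj x i j != 0 -> a h = cj h j j - cj h i i.
Proof.
split=> [/rootspP[sx E]|[sx E]]; last apply/rootspP; split=> //.
  move=> i j h hH xij; apply: (mulIf xij); rewrite -cj_bracketH // E // cjZ.
move=> h hH; apply: cj_inj; apply/matrixP=> i j; rewrite cj_bracketH // cjZ.
by have [->|xij] := eqVneq (cj x i j) 0; [rewrite !mulr0 | rewrite (E i j)].
Qed.

Let rootsp_at a x i j : lin_on H a -> x \in rootsp H a -> cj x i j != 0 -> a = root_at i j.
Proof.
move=> /andP[_ /forallP a0] /rootspE[_ E] xij; apply/ffunP => h; rewrite ffunE.
case: ifPn => hH; first exact: E.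
by have /implyP/(_ hH)/eqP := a0 h.
Qed.

Lemma lin_on_root_at i j : lin_on H (root_at i j).
Proof.
apply/andP; split; last by apply/forallP=> x; apply/implyP=> xH; rewrite ffunE (negPf xH).
apply/forallP => x; apply/forallP => y; apply/forallP => c.
apply/implyP => xH; apply/implyP => yH; rewrite !ffunE xH yH memvD ?memvZ // !cjD !cjZ.
by apply/eqP; ring.
Qed.

(** A nonzero root vector has a nonzero entry in the coordinates where [H] is diagonal, and the
    weight of that entry is the whole functional. *)
Lemma is_root_at a : is_root H a -> exists i j, a = root_at i j.
Proof.
move=> /andP[la]; rewrite -vpick0 => r0; have xr := memv_pick (rootsp H a).
have : cj (vpick (rootsp H a)) != 0.
  by apply: contraNN r0 => /eqP E; apply/eqP/cj_inj; rewrite E cj0.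
move: (vpick _) xr {r0} => x xr x0.
suff [ij E] : exists ij : 'I_3 * 'I_3, cj x ij.1 ij.2 != 0.
  by exists ij.1, ij.2; apply: rootsp_at E.
apply/existsP; rewrite -negb_forall; apply: contraNN x0 => /forallP E.
by apply/eqP/matrixP => i j; rewrite (eqP (E (i, j))) mxE.
Qed.

Let root_at_ii i : root_at i i = 0.
Proof. by apply/ffunP => x; rewrite !ffunE subrr if_same. Qed.

Let ord3_cases (P : 'I_3 -> Prop) : P 0 -> P 1 -> P 2 -> forall i, P i.
Proof.
move=> P0 P1 P2 [[|[|[|//]]] i3]; [move: P0|move: P1|move: P2];
by congr P; apply/val_inj.
Qed.

(** The diagonal elements [3 e_m - 1] separate the weights: [root_at i j] takes on them 3 times a
    difference of Kronecker deltas, and 2 and 3 are invertible. *)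
Lemma root_at_inj i j k l : i != j -> root_at i j = root_at k l -> i = k /\ j = l.
Proof.
move=> ij E.
have T m : (j == m)%:R - (i == m)%:R = (l == m)%:R - (k == m)%:R :> F.
  pose d t : F := 3%:R * (t == m)%:R - 1.
  have d0 : d 0 + d 1 + d 2 = 0.
    by rewrite /d; move: (m); apply: ord3_cases; rewrite /=; ring.
  have := congr1 (fun a : {ffun _ -> F} => a (hd d)) E; rewrite !root_at_hd // /d => E3.
  by apply: (mulfI F3); rewrite !mulrBr; move: E3; rewrite !opprB !addrA !subrK.
have N1 : -1 != 0 :> F by rewrite oppr_eq0 oner_neq0.
have N2 : 1 != -1 :> F by rewrite -subr_eq0 opprK.
have := T j; rewrite eqxx (negPf ij) /= mulr1n mulr0n subr0.
case: (l =P j) => [lj|_].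
  move=> _; split=> //; have := T i.
  rewrite lj eqxx eq_sym (negPf ij) /= mulr1n !mulr0n !sub0r => /eqP.
  by case: (k =P i) => // _; rewrite /= mulr0n oppr0 (negPf N1).
case: (k == j) => e; first by case/eqP: N2; exact: (etrans e (sub0r _)).
by case/eqP: (oner_neq0 F); exact: (etrans e (subr0 _)).
Qed.


Let E' i j := invmx g *m delta_mx i j *m g.

Lemma rootsp_root_at i j : i != j -> rootsp H (root_at i j) = <[E' i j]>%VS.
Proof.
move=> ij; apply/eqP; rewrite eqEsubv; apply/andP; split.
  apply/subvP => x xr; apply/vlineP; exists (cj x i j).
  apply: cj_inj; apply/matrixP => k l; rewrite cjZ cjinv [X in _ * X]mxE.
  have [/= [-> ->]|N] := (k, l) =P (i, j); first by rewrite !eqxx mulr1.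
  have -> : (k == i) && (l == j) = false.
    by apply/negP => /andP[/eqP ki /eqP lj]; case: N; rewrite ki lj.
  rewrite mulr0; apply/eqP; apply: contraT => xkl; case: N.
  have [] := root_at_inj ij (rootsp_at (lin_on_root_at i j) xr xkl).
  by move=> -> ->.
rewrite -memvE; apply/rootspE; split=> [|k l h hH].
  rewrite is_sl_inv /is_sl; apply/eqP; apply: big1 => k _; rewrite mxE.
  by case: (k =P i) => [->|//]; rewrite (negPf ij).
rewrite cjinv [in X in X -> _]mxE ffunE hH; case: (k =P i) => [->|_]; last by rewrite eqxx.
by case: (l =P j) => [->|_]; last by rewrite eqxx.
Qed.

Let negf_root_at i j : negf (root_at i j) = root_at j i.
Proof. by apply/ffunP => x; rewrite !ffunE; case: ifP; rewrite ?opprB ?oppr0. Qed.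

Let bracketZ (c d : F) x y : bracket (c *: x) (d *: y) = (c * d) *: bracket x y.
Proof.
by rewrite /bracket -!scalemxAl -!scalemxAr !scalerA scalerBr [d * c]mulrC.
Qed.

(** Both root spaces are lines, and in diagonal coordinates their generators have bracket
    [E_ii - E_jj], which is nonzero. *)
Lemma dim_root_bracket a : is_root H a -> a != 0 ->
  \dim (commv (rootsp H a) (rootsp H (negf a))) = 1%N.
Proof.
move=> /is_root_at[i [j ->]] a0; have ij : i != j.
  by apply: contraNN a0 => /eqP->; rewrite root_at_ii.
have ji : j != i by rewrite eq_sym.
rewrite negf_root_at !rootsp_root_at //.
suff -> : commv <[E' i j]> <[E' j i]> = <[bracket (E' i j) (E' j i)]>%VS.
  rewrite dim_vline; suff -> : bracket (E' i j) (E' j i) != 0 by [].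
  apply/eqP => /(congr1 cj); rewrite cj_bracket !cjinv cj0 /bracket !mul_delta_mx.
  move/matrixP/(_ i i); rewrite !mxE !eqxx (negPf ij) /= subr0 => /eqP.
  by rewrite mulr1n oner_eq0.
apply/eqP; rewrite eqEsubv; apply/andP; split.
  apply/span_subvP => _ /allpairsP[[x y] /= [xi yj ->]].
  move: xi yj; rewrite !mem_filter => /andP[/vlineP[c ->] _] /andP[/vlineP[d ->] _].
  by rewrite bracketZ memvZ // memv_line.
by rewrite -memvE memv_span // allpairs_f // mem_filter memv_line mem_enum.
Qed.

(** Values of the A_2 weights on [v = e_i - e_j] and on [w], equal to 1 at [i] and [j] and to -2 at
    the third index. Over the integers this finite table is checked by computation, then carried
    over to [F]. *)
Lemma root_values_int i j k l : i != j ->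
  let v : 'I_3 -> int := fun t => (t == i)%:Z - (t == j)%:Z in
  let w : 'I_3 -> int := fun t => 3 * ((t == i)%:Z + (t == j)%:Z) - 2 in
  (w l - w k == 0) && (v l - v k \in [:: 0; 2; - 2]) ||
  (w l - w k \in [:: 3; - 3]) && (v l - v k \in [:: 1; - 1]).
Proof.
by move: i j k l; do 4! apply: ord3_cases.
Qed.

(** Along [a + k b] the value at [w] is constant while the value at [v] drops by 2 at each step;
    four steps already leave the values that [root_values_int] allows. *)
Lemma not_root_string a b : is_root H b -> b != 0 ->
  ~ (forall k : nat, (1 <= k <= p.-1)%N -> is_root H (addmulf a b k)).
Proof.
move=> /is_root_at[i [j ->]] b0 R; have ij : i != j.
  by apply: contraNN b0 => /eqP->; rewrite root_at_ii.
pose v t : F := (t == i)%:R - (t == j)%:R.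
pose w t : F := 3%:R * ((t == i)%:R + (t == j)%:R) - 2%:R.
have v0 : v 0 + v 1 + v 2 = 0.
  by rewrite /v; move: (i) (j); do 2! apply: ord3_cases; rewrite /=; ring.
have w0 : w 0 + w 1 + w 2 = 0.
  by rewrite /w; move: (i) (j) ij; do 2! apply: ord3_cases; rewrite // => _ /=; ring.
have W (k : nat) : (1 <= k <= 4)%N ->
    a (hd w) = 0 /\ a (hd v) - (2 * k)%:R \in [:: 0; 2%:R; - 2%:R] \/
    a (hd w) != 0 /\ a (hd v) - (2 * k)%:R \in [:: 1; -1].
  case/andP=> k1 k4; have : is_root H (addmulf a (root_at i j) k).
    by apply: R; rewrite k1 -ltnS prednK ?(leq_trans _ pchar_prime_gt4) ?(ltnW p3).
  case/is_root_at=> q [r E].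
  have Ew : a (hd w) = w r - w q.
    rewrite -root_at_hd // -E [RHS]ffunE root_at_hd // /w.
    by rewrite !eqxx eq_sym (negPf ij) add0r addr0 subrr mulr0 addr0.
  have Ev : a (hd v) - (2 * k)%:R = v r - v q.
    rewrite -root_at_hd // -E [RHS]ffunE root_at_hd // /v.
    by rewrite !eqxx eq_sym (negPf ij) natrM /=; ring.
  rewrite Ew Ev.
  have -> : v r - v q = (((r == i)%:Z - (r == j)%:Z) - ((q == i)%:Z - (q == j)%:Z))%:~R.
    by rewrite !rmorphB.
  have -> : w r - w q = ((3 * ((r == i)%:Z + (r == j)%:Z) - 2) -
      (3 * ((q == i)%:Z + (q == j)%:Z) - 2))%:~R.
    by rewrite !rmorphB !rmorphM !rmorphD.
  have [] := orP (root_values_int q r ij); case/andP.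
    by move=> /eqP-> vz; left; split=> //; move: vz;
      rewrite !inE => /or3P[] /eqP->; rewrite ?eqxx ?orbT // rmorphN eqxx !orbT.
  move=> wz vz; right; split.
    move: wz; rewrite !inE => /orP[] /eqP->; first exact: F3.
    by rewrite rmorphN oppr_eq0.
  by move: vz; rewrite !inE => /orP[] /eqP->; rewrite ?rmorphN eqxx ?orbT.
have F4 : 4%:R != 0 :> F by apply: natF_neq0; rewrite pchar_prime_gt4.
have F6 : 6%:R != 0 :> F by rewrite (natrM _ 2 3) mulf_neq0.
set s := a (hd v) in W.
have [a0|a0] := eqVneq (a (hd w)) 0.
  have V (k : nat) : (1 <= k <= 4)%N -> s - (2 * k)%:R \in [:: 0; 2%:R; - 2%:R].
    by case/W=> -[//]; rewrite a0 eqxx.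
  have N : (- 4%:R : F) \notin [:: 0; 2%:R; - 2%:R].
    rewrite !inE -[_ == 2%:R]subr_eq0 -[_ == - _]subr_eq0.
    have -> : - 4%:R - 2%:R = - 6%:R :> F by ring.
    have -> : - 4%:R - - 2%:R = - 2%:R :> F by ring.
    by rewrite !oppr_eq0 (negPf F2) (negPf F4) (negPf F6).
  (* The case [k = 1] makes [s] equal to 2, 4 or 0; then [k = 3], 4 or 2 reaches the forbidden value
     -4. *)
  have [k k4 Ek] : exists2 k : nat, (1 <= k <= 4)%N & s - (2 * k)%:R = - 4%:R.
    have := V 1%N isT; rewrite !inE !subr_eq => /or3P[] /eqP->;
      [exists 3%N | exists 4%N | exists 2%N]; rewrite //; ring.
  by move: (V k k4); rewrite Ek (negPf N).
have V (k : nat) : (1 <= k <= 4)%N -> s - (2 * k)%:R \in [:: 1; -1].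
  by case/W=> -[//] /eqP; rewrite (negPf a0).
have N : (- 3%:R : F) \notin [:: 1; -1].
  rewrite !inE -[_ == 1]subr_eq0 -[_ == - _]subr_eq0.
  have -> : - 3%:R - 1 = - 4%:R :> F by ring.
  have -> : - 3%:R - - 1 = - 2%:R :> F by ring.
  by rewrite !oppr_eq0 (negPf F2) (negPf F4).
(* Here [s] is 3 or 1, and [k = 3] or 2 reaches -3. *)
have [k k4 Ek] : exists2 k : nat, (1 <= k <= 4)%N & s - (2 * k)%:R = - 3%:R.
  have := V 1%N isT; rewrite !inE !subr_eq => /orP[] /eqP->;
    [exists 3%N | exists 2%N]; rewrite //; ring.
by move: (V k k4); rewrite Ek (negPf N).
Qed.

Lemma toral_classical : classical_cartan p H.
Proof.
have abH : abelian_sub H by move=> x y; rewrite !memH; apply: torus_comm.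
have sH x : x \in H -> is_sl x by rewrite memH => /andP[].
split=> //; [split | split | exact: dim_root_bracket |].
- by split=> // x y xH yH; rewrite abH ?mem0v.
- exists 1%N => -[|x [|//]] //= y /andP[xH _] _ yH; exact: abH.
- move=> x sx nx; rewrite memH /torus sx; apply/is_diag_mxP => i j ij.
  (* Bracketing with [e_i - e_j] multiplies the entry [(i, j)] by -2, and the result must be
     diagonal. *)
  pose d t : F := (t == i)%:R - (t == j)%:R.
  have d0 : d 0 + d 1 + d 2 = 0.
    by rewrite /d; move: (i) (j); do 2! apply: ord3_cases; rewrite /=; ring.
  have := nx _ (hdH d0); rewrite memH => /andP[_ /is_diag_mxP/(_ i j ij)].
  have jd : d j - d i = - 2%:R.
    have oij : i != j by [].
    by rewrite /d !eqxx [j == i]eq_sym (negPf oij) /=; ring.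
  rewrite -/(cj _) cj_bracketH ?hdH // !cj_hd jd => /eqP.
  by rewrite mulf_eq0 oppr_eq0 (negPf F2) => /eqP.
- apply/eqP; rewrite eqEsubv; apply/andP; split.
    apply/subv_sumP => a la; apply/subvP => x /rootspP[sx _].
    by rewrite mem_slv.
  apply/subvP => x; rewrite mem_slv => sx; apply/memv_sumP.
  (* Each entry of [x] goes to its weight; the diagonal entries go together to the zero functional,
     so the trace stays zero. *)
  pose X a := \matrix_(i, j) (if root_at i j == a then cj x i j else 0).
  exists (fun a => invmx g *m X a *m g) => [a la|].
    apply/rootspE; split=> [|i j h hH].
      rewrite is_sl_inv /is_sl; have [->|a0] := eqVneq a 0.
        rewrite -(eqP sx) -(conj_tr x ug); apply/eqP/eq_bigr => i _.
        by rewrite [LHS]mxE root_at_ii eqxx.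
      by apply/eqP/big1 => i _; rewrite mxE root_at_ii eq_sym (negPf a0).
    rewrite cjinv [X in X != 0]mxE.
    by case: (root_at i j =P a) => [<- _|]; rewrite ?eqxx // ffunE hH.
  apply: cj_inj; apply/matrixP => i j; rewrite cj_sum.
  rewrite (bigD1 (root_at i j)) ?lin_on_root_at //= cjinv.
  rewrite [X in _ = X + _]mxE eqxx big1 ?addr0 //.
  by move=> a /andP[_ aij]; rewrite cjinv mxE eq_sym (negPf aij).
- apply/directv_sum_independent => us us_r sum0 a la.
  apply: cj_inj; rewrite cj0; apply/matrixP => i j.
  (* Only the summand of weight [root_at i j] can have an entry [(i, j)], so the sum vanishes
     summand by summand. *)
  have off b : lin_on H b -> b != root_at i j -> cj (us b) i j = 0.
    move=> lb; apply: contraNeq => uij; apply/eqP; exact: rootsp_at (us_r b lb) uij.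
  have [aij|aij] := eqVneq a (root_at i j); last by rewrite off // mxE.
  rewrite -cj0 -sum0 cj_sum (bigD1 a) //= big1 ?addr0 // => b /andP[lb].
  by rewrite aij; apply: off.
by move=> a b _; apply: not_root_string.
Qed.
End ToralClassical.

(** * Fourier matrices and the tori orthogonal to the diagonal one *)

Section Circulant.
Variable F : finFieldType.
Hypothesis F3 : 3%:R != 0 :> F.
Implicit Types (x y z : 'M[F]_3).

(* [D (c P + d P^2) D^-1] for [D = diag(1, r, s)] and [P] the cyclic shift. *)
Definition circ (r s c d : F) : 'M[F]_3 :=
  mx3 0 (c / r) (d / s) (d * r) 0 (c * r / s) (c * s) (d * s / r) 0.

Lemma mx3_eq (a b c d e f g h k a' b' c' d' e' f' g' h' k' : F) :
  [/\ a = a', b = b' & c = c'] -> [/\ d = d', e = e' & f = f'] ->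
  [/\ g = g', h = h' & k = k'] ->
  mx3 a b c d e f g h k = mx3 a' b' c' d' e' f' g' h' k'.
Proof. by move=> [-> -> ->] [-> -> ->] [-> -> ->]. Qed.

(* The columns of [m] are, up to scaling, [D] times those of the Fourier matrix,
   i.e. the common eigenvectors of the matrices [circ r s c d]. *)
Lemma fourier_torus (w r s t0 t1 t2 : F) :
  let m := mx3 t0 t1 t2 (t0 * r) (t1 * r * w) (t2 * r * w ^+ 2)
               (t0 * s) (t1 * s * w ^+ 2) (t2 * s * w) in
  w ^+ 2 = - w - 1 -> r != 0 -> s != 0 -> t0 != 0 -> t1 != 0 -> t2 != 0 ->
  m \in unitmx /\
  forall z, torus (invmx m) z <-> exists c d, z = circ r s c d.
Proof.
move=> m w2 r0 s0 t00 t10 t20.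
(* The inverse of [m]: up to scalings, one third of the Fourier matrix with [w] and [w ^+ 2]
   exchanged. *)
pose n := mx3 (3%:R * t0)^-1 (3%:R * t0 * r)^-1 (3%:R * t0 * s)^-1
  (3%:R * t1)^-1 (w ^+ 2 / (3%:R * t1 * r)) (w / (3%:R * t1 * s))
  (3%:R * t2)^-1 (w / (3%:R * t2 * r)) (w ^+ 2 / (3%:R * t2 * s)).
have mn : m *m n = 1%:M.
  rewrite mx3_mul mx3_scalar; apply: mx3_eq; split;
    field: w2; by rewrite ?r0 ?s0 ?t00 ?t10 ?t20 ?F3.
have [um _] := mulmx1_unit mn; split=> // z.
have im : invmx m = n by rewrite -[n]mul1mx -(mulVmx um) -mulmxA mn mulmx1.
rewrite /torus invmxK im; split.
  case/andP=> sz; have : \tr (n *m z *m m) = 0.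
    by rewrite mxtrace_mulC mulmxA mn mul1mx (eqP sz).
  have : z = m *m (n *m z *m m) *m n.
    by rewrite !mulmxA mn mul1mx -mulmxA mn mulmx1.
  rewrite (mx3_eta (n *m z *m m)) mx3_tr mx3_diag.
  move: (n *m z *m m) => X -> trX.
  case/and5P => /eqP-> /eqP-> /eqP-> /eqP-> /andP[/eqP-> /eqP->].
  move: (X 0 0) (X 1 1) (X 2 2) trX => d0 d1 d2 trX.
  have -> : d2 = - d0 - d1 by apply/eqP; rewrite -subr_eq0 -trX; apply/eqP; ring.
  (* Inverse Fourier coefficients of the eigenvalues [d0], [d1], [- d0 - d1]. *)
  exists ((d0 + d1 * w ^+ 2 + (- d0 - d1) * w) / 3%:R),
         ((d0 + d1 * w + (- d0 - d1) * w ^+ 2) / 3%:R).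
  rewrite !mx3_mul; apply: mx3_eq; split;
    field: w2; by rewrite ?r0 ?s0 ?t00 ?t10 ?t20 ?F3.
move=> [c [d ->]]; rewrite /is_sl mx3_tr !addr0 eqxx !mx3_mul mx3_diag /=.
do 5? [apply/andP; split]; apply/eqP; field: w2; by rewrite ?r0 ?s0 ?t00 ?t10 ?t20 ?F3.
Qed.

Lemma sum_ord3 (f : 'I_3 -> F) : \sum_i f i = f 0 + f 1 + f 2.
Proof.
rewrite !big_ord_recl big_ord0 addr0 addrA.
by congr (_ + f _ + f _); apply/val_inj.
Qed.

Lemma delta_sandwich n (A B : 'M[F]_n) i j :
  (A *m delta_mx j j *m B) i i = A i j * B j i.
Proof.
rewrite -(mul_delta_mx (0 : 'I_1) j j) mulmxA -colE -mulmxA -rowE.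
by rewrite !mxE big_ord1 !mxE.
Qed.

Lemma tr_delta_mul n (A : 'M[F]_n) i : \tr (delta_mx i i *m A) = A i i.
Proof.
rewrite -(mul_delta_mx (0 : 'I_1) i i) -mulmxA mxtrace_mulC -rowE -colE.
by rewrite trace_mx11 !mxE.
Qed.

Lemma torus1 x : torus 1%:M x = is_sl x && is_diag_mx x.
Proof. by rewrite /torus invmx1 mul1mx mulmx1. Qed.

(* Orthogonality makes [g^-1] a generalized Hadamard matrix: differencing the traces
   over rows and columns shows that the doubly stochastic array
   [m i j * g j i] is constant. *)
Lemma orth_diag_entries g : g \in unitmx ->
  (forall x y, torus 1%:M x -> torus g y -> \tr (x *m y) = 0) ->
  forall i j, 3%:R * (invmx g i j * g j i) = 1.
Proof.
move=> ug orth; set m := invmx g; pose M i j := m i j * g j i.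
have rowM i : M i 0 + M i 1 + M i 2 = 1.
  have := congr1 (fun A : 'M_3 => A i i) (mulVmx ug); rewrite !mxE eqxx /= mulr1n.
  by rewrite sum_ord3 => <-.
have colM j : M 0 j + M 1 j + M 2 j = 1.
  have := congr1 (fun A : 'M_3 => A j j) (mulmxV ug); rewrite !mxE eqxx /= mulr1n.
  by rewrite sum_ord3 => <-; congr (_ + _ + _); apply: mulrC.
have Q i i' j j' : M i j - M i j' = M i' j - M i' j'.
  pose x : 'M[F]_3 := delta_mx i i - delta_mx i' i'.
  pose e : 'M[F]_3 := delta_mx j j - delta_mx j' j'.
  have trd k : \tr (delta_mx k k : 'M[F]_3) = 1.
    by rewrite -[delta_mx _ _]mulmx1 tr_delta_mul mxE eqxx.
  have dd k : is_diag_mx (delta_mx k k : 'M[F]_3).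
    apply/is_diag_mxP => a b ab; rewrite mxE; case: eqP => //= ak; case: eqP => // bk.
    by move: ab; rewrite ak bk eqxx.
  have sx : is_sl x by rewrite /is_sl linearB /= !trd subrr.
  have se : is_sl e by rewrite /is_sl linearB /= !trd subrr.
  have dB a b : is_diag_mx (a : 'M[F]_3) -> is_diag_mx (b : 'M[F]_3) -> is_diag_mx (a - b).
    move=> /is_diag_mxP da /is_diag_mxP db; apply/is_diag_mxP => k l kl.
    by rewrite !mxE da // db // subr0.
  have tx : torus 1%:M x by rewrite torus1 sx dB.
  have ey : g *m (m *m e *m g) *m m = e by rewrite !mulmxA mulmxV // mul1mx mulmxK.
  have ty : torus g (m *m e *m g).
    by rewrite /torus -/m ey dB // andbT /is_sl -(conj_tr _ ug) -/m ey.
  have := orth _ _ tx ty; rewrite /x /e !(mulmxBl, mulmxBr) !linearB /= !tr_delta_mul.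
  rewrite !delta_sandwich -/(M i j) -/(M i j') -/(M i' j) -/(M i' j').
  by move/eqP; rewrite subr_eq0 => /eqP.
(* The difference of two columns is the same in every row, and three copies of it add up to a
   difference of column sums, [1 - 1 = 0]. *)
have Mc i j j' : M i j = M i j'.
  apply/eqP; rewrite -subr_eq0; apply/eqP/(mulfI F3); rewrite mulr0.
  transitivity ((M i j - M i j') + (M i j - M i j') + (M i j - M i j')); first by ring.
  rewrite {1}(Q i 0) {1}(Q i 1) (Q i 2) -(subrr (M 0 j + M 1 j + M 2 j)).
  by rewrite {2}(colM j) -(colM j'); ring.
by move=> i j; rewrite -/(M i j) -[RHS](rowM i) (Mc i 0 j) (Mc i 1 j) (Mc i 2 j); ring.
Qed.

(** The first two elementary symmetric functions vanish, so [a], [b], [c] are the roots of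
    [X^3 - a b c], in geometric progression. *)
Lemma cube_root_triple (a b c : F) : a != 0 -> b != 0 -> c != 0 ->
  a + b + c = 0 -> a^-1 + b^-1 + c^-1 = 0 ->
  exists w, [/\ w ^+ 2 = - w - 1, b = a * w & c = a * w ^+ 2].
Proof.
move=> a0 b0 c0 S T; have Ec : c = - a - b by apply/eqP; rewrite -subr_eq0 -S; apply/eqP; ring.
have E : b ^+ 2 = - a * b - a ^+ 2.
  apply/eqP; rewrite -subr_eq0; apply/eqP.
  (* First symmetric function times [a + b], minus the second one: this is [a^2 + a b + b^2]. *)
  transitivity ((a + b + c) * (a + b) - a * b * c * (a^-1 + b^-1 + c^-1)).
    by field; rewrite a0 b0 c0.
  by rewrite S T mul0r mulr0 subr0.
exists (b / a); split; [ | by field | rewrite Ec]; field: E; exact: a0.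
Qed.

(** The off-diagonal entries of [m g = 1] say that the ratios of two rows of [m] sum to zero, and so
    do their inverses. [cube_root_triple], applied to rows 1 and 2 over row 0, puts [m] in Fourier
    form. *)
Lemma orth_diag_circ g : g \in unitmx ->
  (forall x y, torus 1%:M x -> torus g y -> \tr (x *m y) = 0) ->
  exists r s, [/\ r != 0, s != 0 &
    forall z, torus g z <-> exists c d, z = circ r s c d].
Proof.
move=> ug orth; have E := orth_diag_entries ug orth; set m := invmx g in E.
have m0 i j : m i j != 0.
  by apply: contra_eq_neq (E i j) => ->; rewrite mul0r mulr0 eq_sym oner_neq0.
have gE i j : g j i = (3%:R * m i j)^-1.
  by apply: (mulfI F3); apply: (mulfI (m0 i j)); rewrite mulrCA E invfM; field; rewrite m0.
have S i k : i != k -> m i 0 / m k 0 + m i 1 / m k 1 + m i 2 / m k 2 = 0.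
  move=> ik; have := congr1 (fun A : 'M_3 => A i k) (mulVmx ug).
  rewrite !mxE (negPf ik) sum_ord3 !gE => S.
  apply: (mulfI (invr_neq0 F3)); rewrite mulr0 -[RHS]S -/m.
  by rewrite !mulrDr !invfM ![_ * (3%:R^-1 * _)]mulrCA.
have [w [w2 E11 E12]] : exists w, [/\ w ^+ 2 = - w - 1,
    m 1 1 / m 0 1 = m 1 0 / m 0 0 * w & m 1 2 / m 0 2 = m 1 0 / m 0 0 * w ^+ 2].
  by apply: cube_root_triple; rewrite ?mulf_neq0 ?invr_eq0 ?m0 ?invf_div //; exact: S.
have [v [v2 E21 E22]] : exists v, [/\ v ^+ 2 = - v - 1,
    m 2 1 / m 0 1 = m 2 0 / m 0 0 * v & m 2 2 / m 0 2 = m 2 0 / m 0 0 * v ^+ 2].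
  by apply: cube_root_triple; rewrite ?mulf_neq0 ?invr_eq0 ?m0 ?invf_div //; exact: S.
have col i j : m i j = m 0 j * (m i j / m 0 j) by rewrite mulrC divfK.
have w0 : w != 0.
  by apply: contra_neq (m0 1 1) => w0; rewrite col E11 w0 !mulr0.
(* With the same cube root in both, rows 1 and 2 would be proportional, and their ratios would sum
   to three times a nonzero constant. *)
have vw : v = w ^+ 2.
  have : (v - w) * (v + 1 + w) = 0 by ring: w2 v2.
  move/eqP; rewrite mulf_eq0 => /orP[|/eqP vw]; last first.
    by rewrite w2; apply/eqP; rewrite -subr_eq0 -vw; apply/eqP; ring.
  rewrite subr_eq0 => /eqP vw; have := S 2 1 isT.
  have -> : m 2 1 / m 1 1 = m 2 0 / m 1 0.
    by rewrite (col 2 1) (col 1 1) E11 E21 vw; field; rewrite w0 !m0.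
  have -> : m 2 2 / m 1 2 = m 2 0 / m 1 0.
    by rewrite (col 2 2) (col 1 2) E12 E22 vw; field; rewrite w0 !m0.
  move=> T; have : 3%:R * (m 2 0 / m 1 0) = 0 by rewrite -T; ring.
  by move/eqP; rewrite !mulf_eq0 invr_eq0 (negPf F3) !(negPf (m0 _ _)).
have v_sq : v ^+ 2 = w by rewrite vw; ring: w2.
set r := m 1 0 / m 0 0 in E11 E12; set s := m 2 0 / m 0 0 in E21 E22.
have [r0 s0] : r != 0 /\ s != 0 by rewrite !mulf_neq0 ?invr_eq0.
have Em : m = mx3 (m 0 0) (m 0 1) (m 0 2)
    (m 0 0 * r) (m 0 1 * r * w) (m 0 2 * r * w ^+ 2)
    (m 0 0 * s) (m 0 1 * s * w ^+ 2) (m 0 2 * s * w).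
  rewrite [LHS]mx3_eta; apply: mx3_eq; split=> //; rewrite [LHS]col //.
  - by rewrite E11 mulrA.
  - by rewrite E12 mulrA.
  - by rewrite E21 vw mulrA.
  - by rewrite E22 v_sq mulrA.
have [_] := fourier_torus w2 r0 s0 (m0 0 0) (m0 0 1) (m0 0 2).
by rewrite -Em invmxK => tor; exists r, s.
Qed.

Lemma circ_toral (w r s : F) (H : {vspace 'M[F]_3}) :
  w ^+ 2 = - w - 1 -> r != 0 -> s != 0 ->
  (forall z, z \in H <-> exists c d, z = circ r s c d) -> exists g, toral g H.
Proof.
move=> w2 r0 s0 HE; have n1 := oner_neq0 F.
have /= := fourier_torus w2 r0 s0 n1 n1 n1; set m := mx3 _ _ _ _ _ _ _ _ _ => -[um tor].
exists (invmx m); split=> [|z]; first by rewrite unitmx_inv.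
by apply/idP/idP => [/HE/tor|/tor/HE].
Qed.

(** Two traces show that [r], [s / r], [1 / s] and their inverses sum to zero; as the product is 1,
    [r] is a cube root of 1. The conclusion is shaped for [mem_J3_Hj_circ] with parameters [w ^+ 2]
    and [w]. *)
Lemma orth_circ11 (r s : F) : r != 0 -> s != 0 ->
  (forall c d c' d', \tr (circ 1 1 c d *m circ r s c' d') = 0) ->
  exists w, [/\ w ^+ 2 = - w - 1, r * r = w ^+ 2 * s, s * s = w ^+ 2 * r & r * s = w].
Proof.
move=> r0 s0 orth.
have := orth 1 0 0 1; rewrite /circ mx3_mul mx3_tr => E1.
have := orth 0 1 1 0; rewrite /circ mx3_mul mx3_tr => E2.
have E1' : r + s / r + s^-1 = 0.
  by rewrite -[RHS]E1; field; apply/and3P; split=> //; exact: oner_neq0.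
have E2' : r^-1 + (s / r)^-1 + s^-1^-1 = 0.
  by rewrite -[RHS]E2; field; apply/and3P; split=> //; exact: oner_neq0.
have [||w [w2 Eb Ec]] := cube_root_triple r0 _ _ E1' E2'; rewrite ?mulf_neq0 ?invr_eq0 //.
have w0 : w != 0.
  by apply: contra_neq (mulf_neq0 s0 (invr_neq0 r0)) => w0; rewrite Eb w0 mulr0.
have w3 : w ^+ 3 = 1 by ring: w2.
have Es : s = r * r * w by rewrite -[LHS](divfK r0) Eb; ring.
have r3 : r ^+ 3 = 1.
  have : s * s^-1 = 1 by rewrite divff.
  by rewrite Ec Es => <-; ring: w3.
by exists w; split=> //; rewrite Es; ring: w2 r3.
Qed.

Lemma mem_J3_H0 z : (z \in J3_H0 F) = torus 1%:M z.
Proof.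
rewrite torus1 andbC; apply: mem_vspace_of_pred.
  by rewrite /is_sl linear0 eqxx andbT; apply/is_diag_mxP => i j _; rewrite mxE.
move=> c y z' /andP[/is_diag_mxP dy ty] /andP[/is_diag_mxP dz tz].
rewrite /is_sl mxtraceD mxtraceZ (eqP ty) (eqP tz) mulr0 addr0 eqxx andbT.
by apply/is_diag_mxP => i j ij; rewrite !mxE dy // dz // mulr0 addr0.
Qed.

Definition hj (lam mu c d : F) : 'M[F]_3 :=
  mx3 0 c d (d * mu) 0 (c * lam) (c * mu) (d * lam) 0.

Lemma mem_J3_Hj lam mu z : z \in J3_Hj lam mu <-> exists c d, z = hj lam mu c d.
Proof.
have E c d : hj lam mu c d = c *: mx3 0 1 0 0 0 lam mu 0 0 + d *: mx3 0 0 1 mu 0 0 0 lam 0.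
  by rewrite !mx3_scale mx3_add; apply: mx3_eq; split; ring.
rewrite /J3_Hj span_cons span_seq1; split.
  by case/memv_addP=> _ /vlineP[c ->] [_ /vlineP[d ->] ->]; exists c, d.
by case=> c [d ->]; rewrite E memv_add // memvZ // memv_line.
Qed.

(** [hj lam mu c d] is [circ r s (c * r) (d * s)]; the three equations match the entries outside the
    first row. *)
Lemma mem_J3_Hj_circ (lam mu r s : F) z : r != 0 -> s != 0 ->
  r * r = lam * s -> s * s = lam * r -> r * s = mu ->
  z \in J3_Hj lam mu <-> exists c d, z = circ r s c d.
Proof.
move=> r0 s0 El El' <-; rewrite mem_J3_Hj.
have E1 : lam = r * r / s by rewrite El mulfK.
have E2 : r ^+ 3 = s ^+ 3.
  by rewrite exprSr expr2 El -mulrA [s * r]mulrC mulrA -El' exprSr.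
split=> -[c [d ->]]; [exists (c * r), (d * s) | exists (c / r), (d / s)];
  rewrite /hj /circ E1; apply: mx3_eq; split; field: E2; by rewrite ?r0 ?s0.
Qed.
End Circulant.

(** * Conjugations as Lie algebra automorphisms *)

Section Conjugation.
Variables (F : finFieldType) (n : nat).
Implicit Types (k g x y z : 'M[F]_n).

Lemma lie_aut_conj k : k \in unitmx -> lie_aut (fun z => k *m z *m invmx k).
Proof.
move=> uk; split=> [x|c x y _ _|x y _ _|x y _ _|y sy].
- by rewrite /is_sl conj_tr.
- by rewrite mulmxDr mulmxDl -scalemxAr -scalemxAl.
- by rewrite /bracket mulmxBr mulmxBl !conj_mulmx.
- exact: conj_inj.
exists (invmx k *m y *m k); last by rewrite !mulmxA mulmxV // mul1mx mulmxK.
by rewrite /is_sl mxtrace_mulC mulmxA mulmxV // mul1mx.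
Qed.

Lemma maps_onto_conj k (U V : {vspace 'M[F]_n}) : k \in unitmx ->
  (forall z, z \in U <-> k *m z *m invmx k \in V) ->
  maps_onto (fun z => k *m z *m invmx k) U V.
Proof.
move=> uk E y; split=> [yV|[x /E xV <-] //].
have Ey : k *m (invmx k *m y *m k) *m invmx k = y.
  by rewrite !mulmxA mulmxV // mul1mx mulmxK.
by exists (invmx k *m y *m k); rewrite // E Ey.
Qed.

Lemma invmx_mul g k : g \in unitmx -> k \in unitmx ->
  invmx (g *m k) = invmx k *m invmx g.
Proof.
move=> ug uk; have ugk : g *m k \in unitmx by rewrite unitmx_mul ug.
apply: (can_inj (mulKmx ugk)); rewrite mulmxV //.
by rewrite !mulmxA mulmxK // mulmxV.
Qed.

Lemma torus_conj k g z : k \in unitmx -> g \in unitmx ->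
  torus (g *m invmx k) (k *m z *m invmx k) = torus g z.
Proof.
move=> uk ug; have uik : invmx k \in unitmx by rewrite unitmx_inv.
by rewrite /torus invmx_mul // invmxK /is_sl conj_tr // !mulmxA !mulmxKV.
Qed.

End Conjugation.

(** * The decomposition [J3 u], and conjugacy of every COD to it *)

Section COD.
Variables (F : finFieldType) (p : nat) (u : F).
Hypotheses (pF : p \in [pchar F]) (p3 : (3 < p)%N) (u3 : 3.-primitive_root u).
Implicit Types (x y z : 'M[F]_3).

Let F3 : 3%:R != 0 :> F. Proof. exact: (natF_neq0 pF). Qed.
Let F2 : 2%:R != 0 :> F. Proof. by apply: (natF_neq0 pF); rewrite /= ltnW. Qed.

Let u2 : u ^+ 2 = - u - 1.
Proof.
have uu : u ^+ 3 = 1 by apply: prim_expr_order.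
have u1 : u != 1 by have := eq_prim_root_expr u3 1 0; rewrite expr0 expr1 => ->.
apply/eqP; rewrite -subr_eq0; apply/eqP.
have : (u - 1) * (u ^+ 2 - (- u - 1)) = 0 by ring: uu.
by move/eqP; rewrite mulf_eq0 subr_eq0 (negPf u1) => /eqP.
Qed.

Let u0 : u != 0.
Proof.
by apply: contraTneq (oner_neq0 F) => E; rewrite -(prim_expr_order u3) E expr0n eqxx.
Qed.

Let u20 : u ^+ 2 != 0. Proof. by rewrite expf_neq0. Qed.

Lemma J3_toral i : exists g, toral g (J3 u i).
Proof.
case: i => [[|[|[|[|//]]]] ?]; rewrite /J3 /=.
- by exists 1%:M; split=> [|z]; [exact: unitmx1 | exact: mem_J3_H0].
(* The three circulant tori have [r = 1] and [s = mu], namely 1, [u ^+ 2] and [u]. *)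
- have n1 := oner_neq0 F; apply: (circ_toral F3 u2 n1 n1) => z.
  by apply: mem_J3_Hj_circ; rewrite ?mulr1.
- apply: (circ_toral F3 u2 (oner_neq0 F) u20) => z.
  by apply: mem_J3_Hj_circ; rewrite ?oner_neq0 //; ring: u2.
- apply: (circ_toral F3 u2 (oner_neq0 F) u0) => z.
  by apply: mem_J3_Hj_circ; rewrite ?oner_neq0 //; ring: u2.
Qed.

(** A conjugate of [diag(1, -1, 0)] has square of trace 2, so a torus is never orthogonal to
    itself. *)
Lemma toral_killing g H : toral g H -> exists2 x : 'M[F]_3, x \in H & killing x x != 0.
Proof.
move=> [ug E]; pose d : 'M[F]_3 := mx3 1 0 0 0 (-1) 0 0 0 0.
have cd : g *m (invmx g *m d *m g) *m invmx g = d.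
  by rewrite !mulmxA mulmxV // mul1mx mulmxK.
exists (invmx g *m d *m g).
  rewrite E /torus cd mx3_diag !eqxx andbT /is_sl -(conj_tr _ ug) cd mx3_tr.
  by rewrite subrr addr0 eqxx.
rewrite /killing natrM !mulf_neq0 // -(conj_tr _ ug) conj_mulmx // cd mx3_mul mx3_tr.
rewrite (_ : _ + _ = 2%:R) //; ring.
Qed.

(** The trace factors as [(c d' + d c') (mu + mu' + lam lam')]; for two different components of
    [J3 u] the second factor is [1 + u + u^2]. *)
Lemma hj_orth lam mu lam' mu' x y : mu + mu' + lam * lam' = 0 ->
  x \in J3_Hj lam mu -> y \in J3_Hj lam' mu' -> killing x y = 0.
Proof.
move=> E /mem_J3_Hj[c [d ->]] /mem_J3_Hj[c' [d' ->]].
rewrite /killing mx3_mul mx3_tr.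
transitivity ((2 * 3)%:R * ((c * d' + d * c') * (mu + mu' + lam * lam'))); first by ring.
by rewrite E !mulr0.
Qed.

Lemma H0_hj_orth lam mu x y : x \in J3_H0 F -> y \in J3_Hj lam mu -> killing x y = 0.
Proof.
rewrite mem_J3_H0 torus1 (mx3_eta x) mx3_diag.
case/andP=> _ /and5P[/eqP-> /eqP-> /eqP-> /eqP-> /andP[/eqP-> /eqP->]].
by move=> /mem_J3_Hj[c [d ->]]; rewrite /killing mx3_mul mx3_tr; ring.
Qed.

Lemma killingC x y : killing x y = killing y x.
Proof. by rewrite /killing mxtrace_mulC. Qed.

Lemma J3_orth i j : i != j -> forall x y, x \in J3 u i -> y \in J3 u j -> killing x y = 0.
Proof.
wlog ij : i j / (i < j)%N.
  move=> W ne x y xi yj; have := ne; rewrite -val_eqE neq_ltn => /orP[] ij.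
    exact: (W i j).
  by rewrite killingC (W j i) // eq_sym.
move=> _; case: i j ij => [[|[|[|[|//]]]] ?] [[|[|[|[|//]]]] ?] //= _ x y;
  rewrite /J3 /=; first [exact: H0_hj_orth | apply: hj_orth; ring: u2].
Qed.


Let lam (i : 'I_4) : F := if val i == 1%N then 1 else if val i == 2%N then u else u ^+ 2.
Let mu (i : 'I_4) : F := if val i == 1%N then 1 else if val i == 2%N then u ^+ 2 else u.

(* Inverse discrete Fourier transform over the three components [j > 0]. *)
Definition J3_part z (i : 'I_4) : 'M[F]_3 :=
  if val i == 0%N then mx3 (z 0 0) 0 0 0 (z 1 1) 0 0 0 (z 2 2)
  else hj (lam i) (mu i) ((z 0 1 + mu i * z 1 2 + lam i * z 2 0) / 3%:R)
                         ((z 0 2 + lam i * z 1 0 + mu i * z 2 1) / 3%:R).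

Lemma J3_part_in z i : is_sl z -> J3_part z i \in J3 u i.
Proof.
move=> sz; case: i => [[|[|[|[|//]]]] ?]; rewrite /J3 /J3_part /lam /mu /=;
  [|by apply/mem_J3_Hj; do 2 eexists; reflexivity..].
rewrite mem_J3_H0 torus1 mx3_diag !eqxx /= andbT /is_sl mx3_tr.
by move: sz; rewrite /is_sl /mxtrace sum_ord3.
Qed.

Lemma sum_ord4 (V : zmodType) (f : 'I_4 -> V) : \sum_i f i = f 0 + f 1 + f 2 + f 3.
Proof.
rewrite !big_ord_recl big_ord0 addr0 !addrA.
by congr (_ + f _ + f _ + f _); apply/val_inj.
Qed.

Lemma sum_J3_part z : \sum_i J3_part z i = z.
Proof.
rewrite sum_ord4 /J3_part /lam /mu /= /hj !mx3_add [RHS]mx3_eta.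
by apply: mx3_eq; split; field: u2.
Qed.

(** By [1 + u + u^2 = 0] the transform kills the other components. This left inverse of the sum
    gives directness. *)
Lemma J3_part_sum (us : 'I_4 -> 'M[F]_3) i :
  (forall i, us i \in J3 u i) -> J3_part (\sum_i us i) i = us i.
Proof.
move=> us_in; rewrite sum_ord4.
have := us_in 0; rewrite /J3 /= mem_J3_H0 torus1 (mx3_eta (us 0)) mx3_diag.
case/andP=> _ /and5P[/eqP a1 /eqP a2 /eqP a3 /eqP a4 /andP[/eqP a5 /eqP a6]].
have := us_in 1; rewrite /J3 /= => /mem_J3_Hj[c1 [d1 E1]].
have := us_in 2; rewrite /J3 /= => /mem_J3_Hj[c2 [d2 E2]].
have := us_in 3; rewrite /J3 /= => /mem_J3_Hj[c3 [d3 E3]].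
have [->|->|->|->] : [\/ i = 0, i = 1, i = 2 | i = 3].
  by case: i => [[|[|[|[|//]]]] ?]; [apply: Or41 | apply: Or42 | apply: Or43 | apply: Or44];
    apply/val_inj.
all: rewrite E1 E2 E3 (mx3_eta (us 0)) a1 a2 a3 a4 a5 a6 /hj !mx3_add.
all: rewrite /J3_part /lam /mu /= /hj !mxE /=; apply: mx3_eq; split; by field: u2.
Qed.

Lemma J3_COD : is_COD p (J3 u).
Proof.
split.
- apply/eqP; rewrite eqEsubv; apply/andP; split.
    apply/subv_sumP => i _; apply/subvP => x; rewrite mem_slv.
    by have [g [_ E]] := J3_toral i; rewrite E => /andP[].
  apply/subvP => z; rewrite mem_slv => sz; apply/memv_sumP.
  by exists (J3_part z) => [i _|]; [exact: J3_part_in | rewrite sum_J3_part].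
- apply/directv_sum_independent => us us_in sum0 i _.
  have us_in' j := us_in j isT.
  rewrite -(J3_part_sum i us_in') sum0.
  by have := @J3_part_sum (fun=> 0) i (fun=> mem0v _); rewrite big1.
- by move=> i; have [g tg] := J3_toral i; apply: (toral_classical pF p3 tg).
- exact: J3_orth.
Qed.

(** A component equal to another one would be orthogonal to itself. This yields the uniqueness
    required in [cod_conj]. *)
Lemma J3_inj i j : J3 u i =i J3 u j -> i = j.
Proof.
move=> E; apply/eqP; apply: contraT => ij; have [g tg] := J3_toral i.
have [x xi] := toral_killing tg.
by rewrite (J3_orth ij xi) ?eqxx // -E.
Qed.

Lemma COD_conj H : is_COD p H -> cod_conj H (J3 u).
Proof.
case=> _ _ cH orth.
have [g gE] : exists g : 'I_4 -> 'M[F]_3, forall i, toral (g i) (H i).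
  have ex i : exists g, toral g (H i) := classical_toral F3 (cH i).
  exact: fin_all_exists ex.
have ug i : g i \in unitmx by case: (gE i).
have memH i z : (z \in H i) = torus (g i) z by case: (gE i).
(* Coordinates in which the component [H 0] is diagonal. *)
pose G z := g 0 *m z *m invmx (g 0).
have GE y : G (invmx (g 0) *m y *m g 0) = y.
  by rewrite /G !mulmxA mulmxV // mul1mx mulmxK.
have memH' i z : (z \in H i) = torus (g i *m invmx (g 0)) (G z).
  by rewrite memH torus_conj.
have trH i j x y : i != j -> x \in H i -> y \in H j -> \tr (x *m y) = 0.
  move=> ij xi yj; have /eqP := orth i j ij x y xi yj.
  by rewrite mulf_eq0 natrM mulf_eq0 (negPf F2) (negPf F3) => /eqP.
have circH i : i != 0 -> exists rs : F * F, [/\ rs.1 != 0, rs.2 != 0 &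
    forall z, z \in H i <-> exists c d, G z = circ rs.1 rs.2 c d].
  move=> i0; have [||r [s [r0 s0 E]]] := @orth_diag_circ F F3 (g i *m invmx (g 0)).
  - by rewrite unitmx_mul unitmx_inv !ug.
  - move=> x y tx ty; rewrite -(GE x) -(GE y) /G -conj_mulmx // conj_tr //.
    apply: (trH 0 i); rewrite 1?eq_sym // memH' GE ?mulmxV //.
  by exists (r, s); split=> // z; rewrite memH' E.
have [[r1 s1] /= [r10 s10 E1]] := circH 1 isT.
(* Conjugation by [D] keeps diagonal matrices fixed and turns [circ r1 s1] into [circ 1 1]. *)
pose D : 'M[F]_3 := mx3 1 0 0 0 r1^-1 0 0 0 s1^-1.
pose D' : 'M[F]_3 := mx3 1 0 0 0 r1 0 0 0 s1.
have DD : D *m D' = 1%:M.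
  by rewrite mx3_mul mx3_scalar; apply: mx3_eq; split; field.
have [uD _] := mulmx1_unit DD.
have iD : invmx D = D' by rewrite -[D']mul1mx -(mulVmx uD) -mulmxA DD mulmx1.
have [k kE] : exists k, k = D *m g 0 by eexists.
have uk : k \in unitmx by rewrite kE unitmx_mul uD ug.
pose phi z := k *m z *m invmx k.
have phiE z : phi z = D *m G z *m D'.
  by rewrite /phi kE /G -iD invmx_mul // !mulmxA.
have circD r s c d : r != 0 -> s != 0 -> D *m circ r s c d *m D' = circ (r / r1) (s / s1) c d.
  move=> r0 s0; rewrite !mx3_mul.
  by apply: mx3_eq; split; field; rewrite ?r10 ?s10 ?r0 ?s0.
have phiK y : phi (invmx k *m y *m k) = y.
  by rewrite /phi !mulmxA mulmxV // mul1mx mulmxK.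
have phiH1 z : z \in H 1 <-> exists c d, phi z = circ 1 1 c d.
  have R c d : circ 1 1 c d = D *m circ r1 s1 c d *m D' by rewrite circD // !divff.
  rewrite E1; split=> -[c [d E]]; exists c, d; first by rewrite phiE E R.
  by move: E; rewrite phiE R -iD => /(conj_inj uD).
have phi_circ r s z c d : r != 0 -> s != 0 ->
    G z = circ r s c d <-> phi z = circ (r / r1) (s / s1) c d.
  by move=> r0 s0; rewrite phiE -circD //; split=> [-> //|]; rewrite -iD => /(conj_inj uD).
have phiH i : exists j, forall z, z \in H i <-> phi z \in J3 u j.
  have [->|i0] := eqVneq i 0.
    exists 0 => z; rewrite /J3 /= mem_J3_H0 memH' mulmxV // !torus1 phiE -iD.
    rewrite {2}/is_sl conj_tr // -/(is_sl _).
    have dD : is_diag_mx D by rewrite mx3_diag !eqxx.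
    have dD' : is_diag_mx D' by rewrite mx3_diag !eqxx.
    split=> /andP[-> /=]; rewrite iD.
      by move=> dG; rewrite (is_diag_mxC dD dG) -mulmxA DD mulmx1.
    move=> dG; have <- // : D *m G z *m D' = G z.
    by apply: (conj_inj uD); rewrite iD (is_diag_mxC dD dG) -[LHS]mulmxA DD mulmx1.
  have [->|i1] := eqVneq i 1.
    exists 1 => z; rewrite phiH1 /J3 /=.
    by rewrite (@mem_J3_Hj_circ _ 1 1 1 1) ?oner_neq0 ?mulr1.
  have [[r s] /= [r0 s0 E]] := circH i i0.
  have rr0 : r / r1 != 0 by rewrite mulf_neq0 ?invr_eq0.
  have ss0 : s / s1 != 0 by rewrite mulf_neq0 ?invr_eq0.
  have [|w [w2 Er Es Ew]] := orth_circ11 rr0 ss0.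
    move=> c d c' d'; rewrite -(phiK (circ 1 1 c d)) -(phiK (circ _ _ c' d')).
    rewrite /phi -conj_mulmx // conj_tr //; apply: (trH 1 i); rewrite 1?eq_sym //.
      by apply/phiH1; exists c, d; rewrite phiK.
    by apply/E; exists c', d'; apply/phi_circ; rewrite ?phiK.
  (* [w] is [u] or [u ^+ 2], the two roots of [X^2 + X + 1]; these give the components 3 and 2
     respectively. *)
  have [j Ej] : exists j, J3 u j = J3_Hj (w ^+ 2) w.
    have : (w - u) * (w + 1 + u) = 0 by ring: w2 u2.
    move/eqP; rewrite mulf_eq0 => /orP[|/eqP wu].
      by rewrite subr_eq0 => /eqP->; exists 3.
    have -> : w = u ^+ 2 by rewrite u2; apply/eqP; rewrite -subr_eq0 -wu; apply/eqP; ring.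
    by exists 2; rewrite /J3 /=; congr J3_Hj; ring: u2.
  exists j => z; rewrite Ej (mem_J3_Hj_circ _ rr0 ss0 Er Es Ew).
  by rewrite E; split=> -[c [d /(phi_circ _ _ _ _ _ r0 s0)]]; exists c, d.
exists phi; split; first exact: lie_aut_conj.
move=> i; have [j Ej] := phiH i.
have mj := maps_onto_conj uk Ej; exists j; split=> // j' mj'.
by apply: J3_inj => y; apply/idP/idP => [/mj/mj'|/mj'/mj].
Qed.
End COD.

Theorem theorem3p12 (F : finFieldType) (p : nat) (u : F) :
  p \in [pchar F] -> (3 < p)%N -> (3 %| #|F| - 1)%N ->
  3.-primitive_root u ->
  is_COD p (J3 u) /\
  (forall H : 'I_4 -> {vspace 'M[F]_3}, is_COD p H -> cod_conj H (J3 u)).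
Proof.
by move=> pF p3 _ u3; split=> [|H]; [exact: J3_COD | exact: (COD_conj pF)].
Qed.
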